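(* Let $X$ be a real Banach space and let $f:X\to\mathbb{R}\cup\{\infty\}$ be a locally Lipschitz function with convex domain $\mathrm{dom}\, f$. Let $D\subseteq\mathrm{dom}\, f$ be self segment-dense in $\mathrm{dom}\, f$, and assume that $f$ is locally pseudoconvex on $D$. If the Clarke–Rockafellar subdifferential $\partial^{\uparrow}f$ is lower semicontinuous and has the property that $\langle z^*,x-y\rangle\neq0$ for all $x,y\in\mathrm{dom}\, f$ with $x\neq y$, all $z\in[x,y]\cap (X\setminus D)$ and all $z^*\in\partial^{\uparrow}f(z)$, then $f$ is (globally) pseudoconvex on $X$.
   Context: $X^*$ is the topological dual of $X$, $\langle x^*,x\rangle=x^*(x)$, and $[x,y]=\{x+t(y-x):t\in[0,1]\}$. $\mathrm{dom}\, f=\{x\in X: f(x)\in\mathbb{R}\}$. $f$ is locally Lipschitz if every $x\in\mathrm{dom}\, f$ has an open neighborhood in $X$ on which $f$ is finite and Lipschitz. For $x$ with $f(x)\in\mathbb{R}$ and $v\in X$, the Clarke–Rockafellar generalized derivative is $$f^{\uparrow}(x,v)=\sup_{\epsilon>0}\ \limsup_{(y,\alpha)\downarrow_f x,\ t\downarrow0}\ \inf_{u\in B(v,\epsilon)}\frac{f(y+tu)-\alpha}{t},$$ where $(y,\alpha)\downarrow_f x$ means $y\to x$, $\alpha\to f(x)$, $\alpha\ge f(y)$, and $B(v,\epsilon)$ is the open ball. (For locally Lipschitz $f$ this equals the Clarke directional derivative $\limsup_{y\to x,\,u\to v,\,t\downarrow0}\frac{f(y+tu)-f(y)}{t}$.)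 The Clarke–Rockafellar subdifferential is $\partial^{\uparrow}f(x)=\{x^*\in X^*:\langle x^*,v\rangle\le f^{\uparrow}(x,v)\ \forall v\in X\}$ (empty if $f(x)=\infty$). A set-valued $T:X\rightrightarrows X^*$ with domain $D(T)=\{x:T(x)\neq\emptyset\}$ is lower semicontinuous if for every $x\in D(T)$ and every (norm-)open $N\subseteq X^*$ with $T(x)\cap N\neq\emptyset$ there is a neighborhood $M$ of $x$ with $T(y)\cap N\ne\emptyset$ for all $y\in M\cap D(T)$. $P\subseteq S$ is dense in $S$ if $S\subseteq\mathrm{cl}(P)$. For $U\subseteq V\subseteq X$ with $V$ convex, $U$ is self segment-dense in $V$ if $U$ is dense in $V$ and for all $x,y\in U$ the set $[x,y]\cap U$ is dense in $[x,y]$. $f$ is pseudoconvex if for all $x,y\in\mathrm{dom}\, f$: $f(y)<f(x)\Rightarrow\langle x^*,y-x\rangle<0$ for all $x^*\in\partial^{\uparrow}f(x)$. $f$ is locally pseudoconvex on $D$ if every $z\in D$ has an open neighborhood $U_z$ such that for all $x,y\in U_z\cap D$: $f(y)<f(x)\Rightarrow\langle x^*,y-x\rangle<0$ for all $x^*\in\partial^{\uparrow}f(x)$. *)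

(* Defs.v *)
From HB Require Import structures.
From mathcomp Require Import all_boot all_order all_algebra.
From mathcomp Require Import all_classical all_reals all_analysis.

Set Implicit Arguments.
Unset Strict Implicit.
Unset Printing Implicit Defensive.

Import Order.TTheory GRing.Theory Num.Theory.
Import numFieldNormedType.Exports.

Local Open Scope classical_set_scope.
Local Open Scope ring_scope.

Section Dual.
Context {R : realType} {X : normedModType R}.

(* The topological dual of [X], normed by the operator norm. *)
Definition dual_pred : {pred X -> R^o} :=
  fun g => `[< linear g /\ continuous g >].

Record dual := Dual { dual_fun :> X -> R^o; _ : dual_fun \in dual_pred }.

HB.instance Definition _ := [isSub of dual for dual_fun].
HB.instance Definition _ := [Choice of dual by <:].

Lemma dual_linear (g : dual) : linear g.
Proof. by case: g => g /= /asboolP[]. Qed.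

Lemma dual_continuous (g : dual) : continuous g.
Proof. by case: g => g /= /asboolP[]. Qed.

HB.instance Definition _ (g : dual) :=
  GRing.isLinear.Build R X R^o *:%R (dual_fun g) (dual_linear g).

Lemma dual_submod_closed : submod_closed dual_pred.
Proof.
split=> [|a g h /asboolP[lg cg] /asboolP[lh ch]]; apply/asboolP; split.
- by move=> a u v; rewrite [RHS]addr0 [RHS]scaler0.
- exact: cst_continuous.
- move=> b u v; rewrite -[LHS]/(a *: g (b *: u + v) + h (b *: u + v)).
  by rewrite lg lh !scalerDr !scalerA mulrC addrACA.
- by move=> u; apply: cvgD; [apply: cvgZr; exact: cg|exact: ch].
Qed.

HB.instance Definition _ :=
  GRing.isSubmodClosed.Build R (X -> R^o) dual_pred dual_submod_closed.
HB.instance Definition _ := [SubChoice_isSubLmodule of dual by <:].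

Definition dual_norm (g : dual) : R :=
  sup [set `|g u| | u in [set u : X | `|u| <= 1]].

Lemma dual_norm_has_sup (g : dual) :
  has_sup [set `|g u| | u in [set u : X | `|u| <= 1]].
Proof.
split; first by exists `|g 0|; exists 0; rewrite //= normr0.
have /bounded_funP /(_ 1)[M gM] :=
  (linear_bounded_continuous g).2 (@dual_continuous g).
by exists M => _ [u u1 <-]; exact: gM.
Qed.

Lemma dual_norm_ub (g : dual) (u : X) : `|u| <= 1 -> `|g u| <= dual_norm g.
Proof.
move=> u1; apply: ub_le_sup; first exact: (dual_norm_has_sup g).2.
by exists u.
Qed.

Lemma dual_norm_le (g : dual) (M : R) :
  (forall u : X, `|u| <= 1 -> `|g u| <= M) -> dual_norm g <= M.
Proof.
move=> gM; apply: ge_sup; first exact: (dual_norm_has_sup g).1.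
by move=> _ [u u1 <-]; exact: gM.
Qed.

Lemma dual_normD (g h : dual) : dual_norm (g + h) <= dual_norm g + dual_norm h.
Proof.
apply: dual_norm_le => u u1; rewrite /= (le_trans (ler_normD _ _))//.
by rewrite lerD// dual_norm_ub.
Qed.

Lemma dual_normZ (a : R) (g : dual) : dual_norm (a *: g) = `|a| * dual_norm g.
Proof.
have le_norm b h : dual_norm (b *: h) <= `|b| * dual_norm h.
  by apply: dual_norm_le => u u1; rewrite normrM ler_wpM2l// dual_norm_ub.
apply/eqP; rewrite eq_le le_norm/=.
have [->|a0] := eqVneq a 0.
  rewrite normr0 mul0r; apply: (le_trans (normr_ge0 ((0 *: g : dual) 0))).
  by apply: dual_norm_ub; rewrite normr0.
rewrite -ler_pdivlMl ?normr_gt0// -normfV.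
by rewrite -[g in leLHS](scalerK a0) le_norm.
Qed.

Lemma dual_norm_eq0 (g : dual) : dual_norm g = 0 -> g = 0.
Proof.
move=> g0; apply/val_inj/funext => u /=.
have [->|u0] := eqVneq u 0; first exact: raddf0.
have nu0 : `|u| != 0 by rewrite normr_eq0.
have : `|g (`|u|^-1 *: u)| <= 0.
  by rewrite -g0 dual_norm_ub// normrZ normfV normr_id mulVf.
by rewrite normr_le0 linearZ scaler_eq0 invr_eq0 (negPf nu0) => /eqP.
Qed.

HB.instance Definition _ :=
  Lmodule_isNormed.Build R dual dual_normD dual_normZ dual_norm_eq0.

End Dual.
Arguments dual {R} X.

Section SetsAndMaps.
Context {R : realType} {X : normedModType R}.
Implicit Types (x y : X) (P S U V : set X).

Definition segment x y : set X := [set x + t *: (y - x) | t in `[0, 1]].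

Definition dense_in P S := S `<=` closure P.

(* Only meaningful for [U] contained in a convex set [V]. *)
Definition self_segment_dense U V :=
  dense_in U V /\
  forall x y, U x -> U y -> dense_in (segment x y `&` U) (segment x y).

Definition set_valued_dom (Y : Type) (T : X -> set Y) : set X :=
  [set x | T x !=set0].

Definition lower_semicontinuous_set_valued (Y : topologicalType)
    (T : X -> set Y) :=
  forall x, set_valued_dom T x ->
  forall N : set Y, open N -> T x `&` N !=set0 ->
  exists2 M : set X, nbhs x M &
    forall y, (M `&` set_valued_dom T) y -> T y `&` N !=set0.

End SetsAndMaps.

Section ClarkeRockafellar.
Context {R : realType} {X : normedModType R}.
Implicit Types (f : X -> \bar R) (x y z v : X).

Definition effective_dom f : set X := [set x | f x \is a fin_num].

Definition locally_lipschitz f :=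
  forall x, effective_dom f x -> exists U : set X,
    [/\ open_nbhs x U, U `<=` effective_dom f &
        [lipschitz (fine (f y) : R^o) | y in U]].

(* The filter of ((y, alpha), t) with y --> x, alpha --> f x, f y <= alpha
   and t --> 0, t > 0. *)
Definition epigraph_filter f x : set_system ((X * R) * R) :=
  filter_prod (within [set p | (f p.1 <= p.2%:E)%E] (nbhs (x, fine (f x))))
              (0 : R)^'+.

(* Intended for [f x] finite. *)
Definition clarke_rockafellar_derivative f x v : \bar R :=
  ereal_sup [set
    limf_esup
      (fun p : (X * R) * R =>
        let: ((y, alpha), t) := p in
        ereal_inf [set ((f (y + t *: u)%R - alpha%:E) * (t^-1)%:E)%E
                  | u in ball v e])
      (epigraph_filter f x)
  | e in [set e : R | 0 < e]].

Definition clarke_rockafellar_subdifferential f x : set (dual X) :=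
  [set g | effective_dom f x /\
           forall v, ((g v)%:E <= clarke_rockafellar_derivative f x v)%E].

Definition pseudoconvex_at_pair f x y :=
  (f y < f x)%E ->
  forall g, clarke_rockafellar_subdifferential f x g -> g (y - x) < 0.

Definition pseudoconvex f :=
  forall x y, effective_dom f x -> effective_dom f y ->
  pseudoconvex_at_pair f x y.

Definition locally_pseudoconvex_on (D : set X) f :=
  forall z, D z -> exists2 U : set X, open_nbhs z U &
    forall x y, (U `&` D) x -> (U `&` D) y -> pseudoconvex_at_pair f x y.

End ClarkeRockafellar.

(* Main.v *)
(* Suppose [f y < f x] while some [g] in the subdifferential at [x] satisfies
   [g (y - x) >= 0], and put [v = y - x].  Let [z] be the last point of the
   segment from [x] to [y] at which [f] is maximal on that segment; [z <> y].
   Maximality makes the Clarke derivative at [z] nonnegative along [- v], and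
   along [v] unless [z = x], so Hahn-Banach (or [g] itself when [z = x]) provides
   subgradients [g1] and [g2] at [z] with [g1 v >= 0 >= g2 v].  If [z] is not in
   [D], a convex combination of them vanishes at [v], which the hypothesis on
   the complement of [D] forbids.  If [z] is in [D], then [f] drops strictly
   right after [z] although [g1 v >= 0], against local pseudoconvexity.  The
   Hahn-Banach step rests on the fact that the minimal sublinear functionals
   are the linear ones. *)

From HB Require Import structures.
Require Import Defs.
From mathcomp Require Import all_boot all_order all_algebra.
From mathcomp Require Import all_classical all_reals all_analysis.
From mathcomp Require Import ring lra.

Import Order.TTheory GRing.Theory Num.Theory.
Import numFieldNormedType.Exports.

Local Open Scope classical_set_scope.
Local Open Scope ring_scope.

(** * Sublinear functionals and a Hahn-Banach theorem *)

Section Sublinear.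
Context {R : realType} {V : lmodType R}.
Implicit Types (p q : V -> R) (x y u : V).

(* Equality in the second clause follows by scaling back. *)
Definition sublinear q :=
  (forall x y, q (x + y) <= q x + q y) /\
  (forall (a : R) x, 0 < a -> q (a *: x) <= a * q x).

Lemma sublinearZ q (a : R) x : sublinear q -> 0 <= a -> q (a *: x) = a * q x.
Proof.
move=> [qD qZ]; rewrite le_eqVlt => /predU1P[<-|a0].
  rewrite scale0r mul0r.
  (* Scaling [0] by [2] gives [0 <= q 0], and scaling by [2^-1] gives [q 0 <= 0]. *)
  have := qZ 2 0; have := qZ 2^-1 0.
  by rewrite !scaler0 invr_gt0 ltr0n => /(_ isT) h1 /(_ isT) h2; lra.
apply/eqP; rewrite eq_le qZ//=.
have /(qZ _ (a *: x)) : 0 < a^-1 by rewrite invr_gt0.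
by rewrite scalerA mulVf ?gt_eqF// scale1r ler_pdivlMl.
Qed.

Lemma sublinear0 q : sublinear q -> q 0 = 0.
Proof. by move=> sq; rewrite -(scale0r 0) sublinearZ// mul0r. Qed.

Lemma sublinear_geN q x : sublinear q -> - q (- x) <= q x.
Proof. by move=> sq; have := sq.1 x (- x); rewrite subrr sublinear0//; lra. Qed.

Lemma le_inf_add (E F : set R) c : E !=set0 -> F !=set0 ->
  (forall e d, E e -> F d -> c <= e + d) -> c <= inf E + inf F.
Proof.
move=> E0 F0 cEF; rewrite -lerBlDr; apply: lb_le_inf => // e Ee.
rewrite lerBlDr -lerBlDl; apply: lb_le_inf => // d Fd.
by rewrite lerBlDl cEF.
Qed.

(* A sublinear minorant of [q] that is additive in the direction [u]. *)
Definition sublinear_straighten q u x : R :=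
  inf [set q (x + s *: u) - s * q u | s in [set s | 0 <= s]].

Lemma sublinear_straighten_le q u x s : sublinear q -> 0 <= s ->
  sublinear_straighten q u x <= q (x + s *: u) - s * q u.
Proof.
move=> sq s0; apply: ge_inf; last by exists s.
(* The set is bounded below: [r *: u] is the sum of [x + r *: u] and [- x], so
   [r * q u <= q (x + r *: u) + q (- x)]. *)
exists (- q (- x)) => _ [r r0 <-].
have := sq.1 (x + r *: u) (- x); rewrite addrAC subrr add0r sublinearZ//; lra.
Qed.

Lemma sublinear_straighten_sublinear q u :
  sublinear q -> sublinear (sublinear_straighten q u).
Proof.
move=> sq.
have ne x : [set q (x + s *: u) - s * q u | s in [set s | 0 <= s]] !=set0.
  by exists (q (x + 0 *: u) - 0 * q u); exists 0 => /=.
split=> [x y|a x a0].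
  apply: le_inf_add => // _ _ [r r0 <-] [s s0 <-].
  apply: le_trans (sublinear_straighten_le _ _ _ _ sq (addr_ge0 r0 s0)) _.
  have := sq.1 (x + r *: u) (y + s *: u).
  by rewrite addrACA -scalerDl; lra.
rewrite -ler_pdivrMl//; apply: lb_le_inf => // _ [r /= r0 <-].
rewrite ler_pdivrMl//.
apply: le_trans (sublinear_straighten_le _ _ _ _ sq (mulr_ge0 (ltW a0) r0)) _.
by rewrite -scalerA -scalerDr sublinearZ ?(ltW a0)//; lra.
Qed.

(** Minimality forces [q] to coincide with its straightening along every [u]; the term [s = 1] of
    that infimum then reads [q x <= q (x + u) - q u], the missing half of additivity. *)
Lemma minimal_sublinear_linear q : sublinear q ->
  (forall q', sublinear q' -> (forall x, q' x <= q x) -> q' = q) ->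
  linear (q : V -> R^o).
Proof.
move=> sq qmin.
have straightE u : sublinear_straighten q u = q.
  apply: qmin; first exact: sublinear_straighten_sublinear.
  move=> x; apply: le_trans (sublinear_straighten_le q u x 0 sq (lexx 0)) _.
  by rewrite scale0r mul0r addr0 subr0.
have qD x u : q (x + u) = q x + q u.
  apply/eqP; rewrite eq_le sq.1/=.
  have := sublinear_straighten_le q u x 1 sq ler01.
  by rewrite straightE scale1r mul1r; lra.
have qN x : q (- x) = - q x.
  by have := qD x (- x); rewrite subrr sublinear0//; lra.
move=> a x y; rewrite -[RHS]/(a * q x + q y) qD; congr (_ + _).
have [a0|/ltW a0] := leP 0 a; first exact: sublinearZ.
by rewrite -[in LHS](opprK a) scaleNr qN sublinearZ ?oppr_ge0//; lra.
Qed.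

(** Zorn's lemma, with the order reversed so that maximal means smallest; a nonempty chain is
    bounded by its pointwise infimum. *)
Lemma exists_minimal_sublinear p : sublinear p ->
  exists q, [/\ sublinear q, forall x, q x <= p x &
    forall q', sublinear q' -> (forall x, q' x <= q x) -> q' = q].
Proof.
move=> sp.
pose T := {q : V -> R | sublinear q /\ forall x, q x <= p x}.
pose le (q r : T) := `[< forall x, sval r x <= sval q x >].
suff [[q [sq qp]] qmin] : exists t : T, forall s, le t s -> s = t.
  exists q; split => // r sr rq.
  have rp x : r x <= p x by exact: le_trans (rq x) (qp x).
  have := qmin (exist _ r (conj sr rp)).
  by rewrite /le asboolT//= => /(_ isT)[].
apply: Zorn.
- by move=> q; apply/asboolP.
- move=> q r s /asboolP rq /asboolP sr; apply/asboolP => x.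
  exact: le_trans (sr x) (rq x).
- move=> [q hq] [r hr] /asboolP/= rq /asboolP/= qr.
  have qrE : q = r by apply/funext => x; apply/le_anti; rewrite rq qr.
  by move: hq hr; rewrite qrE => hq hr; congr exist; exact: Prop_irrelevance.
move=> A Atot; have [[q0 Aq0]|A0] := pselect (A !=set0); last first.
  exists (exist _ p (conj sp (fun x => lexx (p x)))) => q Aq.
  by exfalso; apply: A0; exists q.
pose I x := inf [set sval q x | q in A].
have I_le (q : T) x : A q -> I x <= sval q x.
  move=> Aq; apply: ge_inf; last by exists q.
  exists (- p (- x)) => _ [r _ <-]; case: r => r [sr rp] /=.
  by apply: le_trans (sublinear_geN r x sr); rewrite lerN2.
have ne x : [set sval q x | q in A] !=set0 by exists (sval q0 x); exists q0.
have sI : sublinear I.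
  split=> [x y|a x a0].
    apply: le_inf_add => // _ _ [q Aq <-] [r Ar <-].
    (* Of two members of the chain, the smaller one serves at both points. *)
    have [/asboolP rq|/asboolP qr] := Atot q r Aq Ar.
      apply: le_trans (I_le _ _ Ar) _.
      by apply: le_trans ((svalP r).1.1 x y) _; rewrite lerD2r.
    apply: le_trans (I_le _ _ Aq) _.
    by apply: le_trans ((svalP q).1.1 x y) _; rewrite lerD2l.
  rewrite -ler_pdivrMl//; apply: lb_le_inf => // _ [q Aq <-].
  rewrite ler_pdivrMl//; apply: le_trans (I_le _ _ Aq) _.
  exact: (svalP q).1.2.
have Ip x : I x <= p x by exact: le_trans (I_le _ x Aq0) ((svalP q0).2 x).
by exists (exist _ I (conj sI Ip)) => q Aq; apply/asboolP => x /=; exact: I_le.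
Qed.

(** Take [g] minimal below the straightening of [p] along [v]. The straightening is at most [- p v]
    at [- v] (term [s = 1]), hence [g v >= p v]. *)
Lemma hahn_banach_sublinear p v : sublinear p ->
  exists g : V -> R^o, [/\ linear g, forall x, g x <= p x & g v = p v].
Proof.
move=> sp; set pv := sublinear_straighten p v.
have [g [sg gpv gmin]] :=
  exists_minimal_sublinear _ (sublinear_straighten_sublinear _ v sp).
have pvp x : pv x <= p x.
  have := sublinear_straighten_le p v x 0 sp (lexx 0).
  by rewrite scale0r mul0r addr0 subr0.
exists g; split => //; first exact: minimal_sublinear_linear.
  by move=> x; exact: le_trans (gpv x) (pvp x).
apply/le_anti; rewrite (le_trans (gpv v) (pvp v))/=.
have := sublinear_straighten_le p v (- v) 1 sp ler01.
rewrite scale1r addNr sublinear0// mul1r sub0r => pvN.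
have := sublinear_geN g v sg; have := gpv (- v); rewrite -/pv in pvN *; lra.
Qed.

End Sublinear.

(** * The Clarke directional derivative as a sublinear functional *)

Section ClarkeDerivative.
Context {R : realType} {X : normedModType R} (h : X -> R) (z : X).
Implicit Types (u v y : X) (c d : R).

Definition clarke_bounds v : set R :=
  [set c | exists2 d : R, 0 < d & forall y (t : R), ball z d y -> 0 < t < d ->
             h (y + t *: v) - h y <= t * c].

(* The limsup over [y --> z] and [t --> 0+] of the difference quotients. *)
Definition clarke_derivative v : R := inf (clarke_bounds v).

Lemma ball_translate d v : 0 < d -> exists d' : R, [/\ 0 < d', d' <= d &
  forall y (t : R), ball z d' y -> 0 < t < d' -> ball z d (y + t *: v)].
Proof.
move=> d0; have v1 : 0 < 1 + `|v| by rewrite ltr_wpDr.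
(* This radius times one plus the norm of [v] is [d]: the first share absorbs [y], the other the
   shift [t *: v]. *)
exists (d / (1 + `|v|)); split.
- by rewrite divr_gt0.
- by rewrite ler_pdivrMr// ler_peMr ?ler_wpDr// ltW.
- move=> y t; rewrite -!ball_normE/= => zy /andP[t0 td].
  rewrite opprD addrA (le_lt_trans (ler_normB _ _))// normrZ (gtr0_norm t0).
  rewrite -[ltRHS](@divfK _ (1 + `|v|)) ?gt_eqF// mulrDr mulr1.
  by rewrite ltr_leD// ler_wpM2r// ltW.
Qed.

Lemma clarke_boundsD u v c c' :
  clarke_bounds u c -> clarke_bounds v c' -> clarke_bounds (u + v) (c + c').
Proof.
move=> [d d0 dc] [e e0 ec].
(* The increment along [u + v] passes through [y + t *: u], which must stay in the ball where the
   bound for [v] holds. *)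
have [k [k0 ke kv]] := ball_translate e u e0.
exists (Num.min d k) => [|y t zy]; first by rewrite lt_min d0.
rewrite lt_min => /and3P[t0 td tk].
have zk : ball z k y by apply: le_ball zy; rewrite ge_min lexx orbT.
have zd : ball z d y by apply: le_ball zy; rewrite ge_min lexx.
have := dc y t zd; have := ec (y + t *: u) t.
rewrite t0 td (lt_le_trans tk ke)/= => /(_ _ isT) h1 /(_ isT) h2.
have {}h1 := h1 (kv y t zk _).
by rewrite scalerDr addrA; move: h1; rewrite t0 tk => /(_ isT); lra.
Qed.

Lemma clarke_boundsZ (a : R) v c : 0 < a ->
  clarke_bounds v c -> clarke_bounds (a *: v) (a * c).
Proof.
move=> a0 [d d0 dc]; exists (Num.min d (d / a)).
  by rewrite lt_min d0 divr_gt0.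
move=> y t zy; rewrite lt_min => /and3P[t0 td].
rewrite ltr_pdivlMr// => tda; rewrite scalerA mulrA; apply: dc.
  by apply: le_ball zy; rewrite ge_min lexx.
by rewrite mulr_gt0.
Qed.

Lemma clarke_derivative_ge0 v : clarke_bounds v !=set0 ->
  (forall d, 0 < d -> exists y t,
     [/\ ball z d y, 0 < t < d & h y <= h (y + t *: v)]) ->
  0 <= clarke_derivative v.
Proof.
move=> ne hv; apply: lb_le_inf => // c [d d0 dc].
have [y [t [zy td hy]]] := hv d d0.
have := dc y t zy td; case/andP: td => t0 _.
by rewrite -(pmulr_rge0 c t0); lra.
Qed.

Context (r L : R) (r0 : 0 < r).
Context (hL : forall y y', ball z r y -> ball z r y' ->
  `|h y - h y'| <= L * `|y - y'|).

Lemma clarke_bounds_lipschitz v : clarke_bounds v (L * `|v|).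
Proof.
have [d [d0 dr zd]] := ball_translate r v r0.
exists d => // y t zy /[dup] td /andP[t0 _].
rewrite (le_trans (ler_norm _))// (le_trans (hL _ _ _ _))//.
- exact: zd.
- exact: le_ball zy.
- by rewrite addrC addKr normrZ (gtr0_norm t0) mulrCA.
Qed.

(** Test the bound at [y = z] with a small [t]. This makes the [inf] in [clarke_derivative] a
    genuine infimum and not a default value. *)
Lemma clarke_bounds_ge v c : clarke_bounds v c -> - (L * `|v|) <= c.
Proof.
move=> [d d0 dc]; have [k [k0 kr zk]] := ball_translate r v r0.
pose t := Num.min d k / 2.
have m0 : 0 < Num.min d k by rewrite lt_min d0.
have t0 : 0 < t by rewrite divr_gt0.
have tm : t < Num.min d k by rewrite ltr_pdivrMr// ltr_pMr// ltr1n.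
have td : 0 < t < d by rewrite t0 (lt_le_trans tm)// ge_min lexx.
have tk : 0 < t < k by rewrite t0 (lt_le_trans tm)// ge_min lexx orbT.
have := dc z t (ballxx z d0) td.
have := hL _ _ (zk z t (ballxx z k0) tk) (ballxx z r0).
rewrite [X in L * `|X|]addrAC subrr add0r normrZ (gtr0_norm t0).
rewrite ler_norml => /andP[+ _]; move=> hLip hc; rewrite -(ler_pM2l t0); lra.
Qed.

Lemma clarke_bounds_has_inf v : has_inf (clarke_bounds v).
Proof.
split; first by exists (L * `|v|); exact: clarke_bounds_lipschitz.
by exists (- (L * `|v|)) => c; exact: clarke_bounds_ge.
Qed.

Lemma clarke_derivative_le v : clarke_derivative v <= L * `|v|.
Proof.
apply: ge_inf; first exact: (clarke_bounds_has_inf v).2.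
exact: clarke_bounds_lipschitz.
Qed.

Lemma clarke_derivative_sublinear : sublinear clarke_derivative.
Proof.
have lb v := (clarke_bounds_has_inf v).2.
have ne v := (clarke_bounds_has_inf v).1.
split=> [u v|a v a0].
  apply: le_inf_add => // c c' uc vc'.
  by apply: ge_inf => //; exact: clarke_boundsD.
rewrite -ler_pdivrMl//; apply: lb_le_inf => // c vc.
by rewrite ler_pdivrMl//; apply: ge_inf => //; exact: clarke_boundsZ.
Qed.

Lemma exists_quotient_gt v c d : c < clarke_derivative v -> 0 < d ->
  exists y t, [/\ ball z d y, 0 < t < d & t * c < h (y + t *: v) - h y].
Proof.
move=> cv d0; apply: contrapT => nex.
suff /(ge_inf (clarke_bounds_has_inf v).2) : clarke_bounds v c.
  by rewrite leNgt -/(clarke_derivative v) cv.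
exists d => // y t zy td; rewrite leNgt; apply/negP => hc.
by apply: nex; exists y, t.
Qed.

End ClarkeDerivative.

(** * Subgradients of locally Lipschitz functions *)

Section LocallyLipschitz.
Context {R : realType} {X : normedModType R} (f : X -> \bar R).
Context (f_lip : locally_lipschitz f).
Implicit Types (x y z u v : X).

Lemma locally_lipschitz_ball z : effective_dom f z ->
  exists r L : R, [/\ 0 < r, 0 < L, ball z r `<=` effective_dom f &
    forall y y', ball z r y -> ball z r y' ->
      `|fine (f y) - fine (f y')| <= L * `|y - y'|].
Proof.
move=> /f_lip[U [[oU Uz] Udom fU]].
have /nbhs_ballP[r /= r0 rU] := open_nbhs_nbhs (conj oU Uz).
have [L L0 fL] := pinfty_ex_gt0 fU.
exists r, L; split => // [y /rU/Udom//|y y' /rU Uy /rU Uy'].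
exact: (fL (y, y')).
Qed.

Lemma near_effective_dom z : effective_dom f z ->
  \forall y \near z, effective_dom f y.
Proof.
move=> /locally_lipschitz_ball[r [L [r0 _ rdom _]]].
by apply/nbhs_ballP; exists r.
Qed.

Lemma locally_lipschitz_continuous z : effective_dom f z ->
  {for z, continuous (fine \o f)}.
Proof.
move=> /locally_lipschitz_ball[r [L [r0 L0 _ fL]]].
apply/cvgrPdist_lt => e e0; apply/nbhs_ballP.
exists (Num.min r (e / L)) => /=; first by rewrite lt_min r0 divr_gt0.
move=> y zy; have zry : ball z r y by apply: le_ball zy; rewrite ge_min lexx.
have : ball z (e / L) y by apply: le_ball zy; rewrite ge_min lexx orbT.
rewrite -ball_normE/= ltr_pdivlMr// mulrC; apply: le_lt_trans.
by apply: fL => //; exact: ballxx.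
Qed.

(** Turns a functional below the Clarke derivative into a Clarke-Rockafellar subgradient. The
    infimum over [u] near [v] costs at most the Lipschitz constant times the radius of the ball. *)
Lemma clarke_derivative_le_clarke_rockafellar z v : effective_dom f z ->
  ((clarke_derivative (fine \o f) z v)%:E <=
    clarke_rockafellar_derivative f z v)%E.
Proof.
move=> /locally_lipschitz_ball[r [L [r0 L0 rdom fL]]].
set p := clarke_derivative _ _ _; apply/lee_subgt0Pr => e e0.
(* [L * eps = e / 2]: one half of [e] pays for replacing [v] by [u], the other for a nearly optimal
   quotient. *)
pose eps := e / 2 / L.
have eps0 : 0 < eps by rewrite !divr_gt0.
apply: le_ereal_sup_tmp; eexists; first by exists eps.
apply: le_ereal_inf_tmp => _ [V [[P Q] /= [zP Q0] PQV] <-].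
have /nbhs_ballP[a /= a0 aP] := zP; have /nbhs_ballP[b /= b0 bQ] := Q0.
have vL : 0 < 1 + `|v| + eps by rewrite ltr_wpDl// addr_ge0.
(* In order: [y] is close to [z], [f y] is close to [f z], [t] lies in [Q], and [y + t *: u] stays
   in the Lipschitz ball. *)
pose d := Num.min (Num.min a (a / L)) (Num.min b (r / (1 + `|v| + eps))).
have d0 : 0 < d by rewrite !lt_min a0 b0 !divr_gt0.
have pe : p - e / 2 < p by rewrite ltrBlDr ltrDl divr_gt0.
have [y [t [zy /andP[t0 td] pt]]] :=
  exists_quotient_gt _ _ _ _ r0 fL v _ d pe d0.
have /and4P[da daL db dr] : [&& d <= a, d <= a / L, d <= b &
    d <= r / (1 + `|v| + eps)].
  by rewrite !ge_min !lexx /= !orbT.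
have zyd : `|z - y| < d by move: zy; rewrite -ball_normE.
have shift u : ball v eps u -> ball z r (y + t *: u).
  rewrite -!ball_normE/= => vu; rewrite opprD addrA.
  rewrite (le_lt_trans (ler_normB _ _))// normrZ (gtr0_norm t0).
  have uv : `|u| <= `|v| + eps.
    rewrite -[u](subrK v) (le_trans (ler_normD _ _))// addrC lerD2l.
    by rewrite distrC ltW.
  have : t * `|u| <= d * (`|v| + eps) by rewrite ler_pM// ltW.
  by move: dr; rewrite ler_pdivlMr//; lra.
have yr : ball z r y.
  apply: le_ball zy; rewrite (le_trans dr)// ler_pdivrMr// ler_peMr ?(ltW r0)//.
  by rewrite -addrA lerDl addr_ge0// ltW.
have fy : f y \is a fin_num := rdom _ yr.
(* The height [alpha] is taken to be [f y], which leaves an ordinary difference quotient. *)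
apply: le_ereal_sup_tmp; exists (ereal_inf
  [set ((f (y + t *: u)%R - (fine (f y))%:E) * (t^-1)%:E)%E
     | u in ball v eps]).
  exists ((y, fine (f y)), t) => //; apply: PQV; split => /=.
    apply: aP => /=; last by rewrite fineK.
    split => /=; first by apply: le_ball zy.
    rewrite -ball_normE/= (le_lt_trans (fL _ _ (ballxx z r0) yr))//.
    rewrite mulrC -ltr_pdivlMr//.
    exact: lt_le_trans zyd daL.
  apply: bQ => //=; rewrite -ball_normE/= sub0r normrN gtr0_norm//.
  exact: lt_le_trans td db.
apply: le_ereal_inf_tmp => _ [u vu <-].
rewrite -[f (y + t *: u)]fineK; last exact: rdom (shift u vu).
rewrite -2!EFinB -EFinM lee_fin ler_pdivlMr//.
have := fL _ _ (shift v (ballxx v eps0)) (shift u vu).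
rewrite [in X in L * X]opprD addrACA subrr add0r -scalerBr normrZ.
rewrite (gtr0_norm t0) => hL.
have vu' : L * (t * `|v - u|) <= t * (e / 2).
  rewrite mulrCA ler_pM2l// mulrC -ler_pdivlMr//.
  by move: vu; rewrite -ball_normE/= => /ltW.
have := le_trans (ler_norm _) hL.
move: pt => /=; lra.
Qed.

(** Quotients based at [z - s *: v] with step [s] end at [z], so they are nonnegative and so is the
    Clarke derivative along [v]. Hahn-Banach yields a [g] attaining it, continuous by the Lipschitz
    bound. *)
Lemma subdifferential_ge0 z v : effective_dom f z ->
  (exists2 e : R, 0 < e & forall s, 0 < s < e ->
     fine (f (z - s *: v)) <= fine (f z)) ->
  exists2 g, clarke_rockafellar_subdifferential f z g & 0 <= g v.
Proof.
move=> zdom [e e0 fe].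
have [r [L [r0 L0 rdom fL]]] := locally_lipschitz_ball z zdom.
have sp := clarke_derivative_sublinear (fine \o f) z r L r0 fL.
have [g [glin gp gv]] := hahn_banach_sublinear _ v sp.
pose gl : {linear X -> R^o} := HB.pack g
  (GRing.isLinear.Build R X R^o *:%R g glin).
have gL x : g x <= L * `|x|.
  exact: le_trans (gp x) (clarke_derivative_le _ _ _ _ r0 fL x).
have gc : continuous gl.
  apply/linear_bounded_continuous/bounded_funP => k.
  exists (L * k) => x xk; have Lxk : L * `|x| <= L * k by rewrite ler_pM2l.
  apply: le_trans Lxk; rewrite ler_norml gL andbT lerNl.
  by rewrite -(linearN gl) (le_trans (gL _))// normrN.
have gd : g \in dual_pred by apply/asboolP; split.
exists (Dual gd).
  split=> // x.
  apply: le_trans (clarke_derivative_le_clarke_rockafellar z x zdom).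
  by rewrite lee_fin; exact: gp.
rewrite /= gv; apply: clarke_derivative_ge0.
  by exists (L * `|v|); exact: clarke_bounds_lipschitz r0 fL _.
move=> d d0; have [d' [d'0 d'd zd']] := ball_translate z d (- v) d0.
have m0 : 0 < Num.min d' e by rewrite lt_min d'0.
have s0 : 0 < Num.min d' e / 2 by rewrite divr_gt0.
have sm : Num.min d' e / 2 < Num.min d' e.
  by rewrite ltr_pdivrMr// ltr_pMr// ltr1n.
move: (Num.min d' e / 2) s0 sm => s s0; rewrite lt_min => /andP[sd' se].
exists (z - s *: v), s; split.
- by rewrite -scalerN; apply: zd'; [exact: ballxx|rewrite s0].
- by rewrite s0 (lt_le_trans sd').
- by rewrite subrK; apply: fe; rewrite s0.
Qed.

Lemma subdifferential_convex z (g g' : dual X) (a : R) : 0 <= a <= 1 ->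
  clarke_rockafellar_subdifferential f z g ->
  clarke_rockafellar_subdifferential f z g' ->
  clarke_rockafellar_subdifferential f z (a *: g + (1 - a) *: g').
Proof.
move=> /andP[a0 a1] [zdom gz] [_ g'z]; split=> // v.
(* Passing through the real maximum avoids arithmetic with the extended-real derivative. *)
have gmax : ((Num.max (g v : R) (g' v))%:E <=
    clarke_rockafellar_derivative f z v)%E.
  by rewrite /Num.max; case: ifP.
apply: le_trans gmax; rewrite lee_fin.
rewrite -[leLHS]/(a * g v + (1 - a) * g' v).
have gm : g v <= Num.max (g v : R) (g' v) by rewrite le_max lexx.
have g'm : g' v <= Num.max (g v : R) (g' v) by rewrite le_max lexx orbT.
have := ler_wpM2l a0 gm.
have a1' : 0 <= 1 - a by rewrite subr_ge0.
have := ler_wpM2l a1' g'm; lra.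
Qed.

End LocallyLipschitz.

(** [t] is the supremum of the maximizers, itself a maximizer by continuity. *)
Lemma exists_last_argmax (R : realType) (phi : R -> R) (a b : R) :
  a <= b -> {in `[a, b], continuous phi} ->
  exists2 t, t \in `[a, b] &
    (forall s, s \in `[a, b] -> phi s <= phi t) /\
    (forall s, s \in `[a, b] -> t < s -> phi s < phi t).
Proof.
move=> ab cphi.
have [|c cab cmax] := @EVT_max R phi a b ab.
  by apply: continuous_in_subspaceT => t /set_mem tab; exact: cphi.
pose A := [set t | t \in `[a, b] /\ phi t = phi c].
have Asup : has_sup A.
  by split; [exists c|exists b => t [/itvP-> _]].
pose t := sup A.
have At s : A s -> s <= t by move=> As; exact: ub_le_sup Asup.2 _ As.
have tab : t \in `[a, b].
  rewrite in_itv/=; apply/andP; split.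
    by apply: le_trans (At c _) => //; move/itvP: cab => ->.
  by apply: ge_sup; [exact: Asup.1|move=> s [/itvP-> _]].
have phit : phi t = phi c.
  apply: contrapT => /eqP phitc.
  have {}phitc : phi t < phi c by rewrite lt_neqAle phitc cmax.
  have /nbhs_ballP[e /= e0 eA] : \forall s \near t, phi s < phi c.
    exact: (cvgr_lt _ (cphi t tab)).
  have [s As ts] := sup_adherent e0 Asup.
  have : phi s < phi c.
    apply: eA; rewrite -ball_normE/= ger0_norm ?subr_ge0 ?At//.
    by move: ts; rewrite -/t; lra.
  by rewrite As.2 ltxx.
exists t => //; rewrite phit; split=> // s sab ts.
rewrite lt_neqAle cmax// andbT; apply/eqP => phis.
by have := At s (conj sab phis); rewrite leNgt ts.
Qed.

(** * Local pseudoconvexity extended from [D] by density *)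

Section Pseudoconvexity.
Context {R : realType} {X : normedModType R} (f : X -> \bar R).
Context (f_lip : locally_lipschitz f).
Implicit Types (x y z u v : X).

Lemma effective_dom_segment x y (t : R) :
  convex_set (effective_dom f : set (convex_lmodType X)) ->
  effective_dom f x -> effective_dom f y -> t \in `[0, 1] ->
  effective_dom f (x + t *: (y - x)).
Proof.
move=> cvx xdom ydom; rewrite in_itv/= => /andP[t0 t1].
have := cvx y x (Itv01 t0 t1) (mem_set ydom) (mem_set xdom).
move=> /set_mem; congr (effective_dom f _).
by rewrite /conv /= /unstable.onem scalerBl scale1r scalerBr addrCA.
Qed.

(* Density of [D] only yields [g (y - z) <= 0]; were it an equality, [y] would
   be a local maximum of [g (_ - z)], hence [g = 0], which the points of [D]
   near [y] rule out. *)
Lemma pseudoconvex_at_dense (D U : set X) z y (g : dual X) :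
  dense_in D (effective_dom f) -> open U ->
  (forall w, (U `&` D) w -> pseudoconvex_at_pair f z w) ->
  clarke_rockafellar_subdifferential f z g ->
  effective_dom f z -> effective_dom f y -> U y -> (f y < f z)%E ->
  g (y - z) < 0.
Proof.
move=> Ddense oU UD gz zdom ydom Uy fyz.
have lt_near : \forall w \near y, [/\ U w, effective_dom f w & (f w < f z)%E].
  have hyz : fine (f y) < fine (f z) by rewrite -lte_fin !fineK.
  have hy : \forall w \near y, fine (f w) < fine (f z).
    exact: cvgr_lt (locally_lipschitz_continuous f f_lip y ydom) _ hyz.
  have ydom_near := near_effective_dom f f_lip y ydom.
  have Uy_near := open_nbhs_nbhs (conj oU Uy).
  apply: filterS3 ydom_near Uy_near hy => w wdom Uw hw; split => //.
  by rewrite -[f w]fineK// -[f z]fineK// lte_fin.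
have g_le0 : \forall w \near y, g (w - z) <= 0.
  (* [near_join] gives points [w] with the property of [lt_near] on a whole neighborhood; if
     [g (w - z)] were positive, some point of [D] close to [w] would inherit this. *)
  have := near_join lt_near; apply: filterS => w wnear.
  have [_ wdom _] := nbhs_singleton wnear.
  rewrite leNgt; apply/negP => gw.
  have gc : {for w, continuous (fun w' => g (w' - z))}.
    apply: (@continuous_comp _ _ _ (fun w' => w' - z) g).
      by apply: cvgB; [exact: cvg_id|exact: cvg_cst].
    exact: dual_continuous.
  have gw' : \forall w' \near w, 0 < g (w' - z).
    exact: cvgr_gt gc _ gw.
  have [w' [Dw' [[Uw' _ fw'] gw'0]]] :=
    Ddense w wdom _ (filterI wnear gw').
  by have := UD w' (conj Uw' Dw') fw' g gz; rewrite ltNge ltW.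
rewrite lt_neqAle (nbhs_singleton g_le0) andbT; apply/eqP => gyz.
have g_le u : g u <= 0.
  have /nbhs_ballP[e /= e0 eg] := g_le0.
  have [d [d0 _ dy]] := ball_translate y e u e0.
  have d2 : 0 < d / 2 < d by rewrite divr_gt0//= ltr_pdivrMr// ltr_pMr// ltr1n.
  have := eg _ (dy y (d / 2) (ballxx y d0) d2).
  rewrite addrAC linearD/= gyz add0r linearZ/= -[_ *: _]/(d / 2 * g u).
  by case/andP: d2 => d20 _; rewrite pmulr_rle0.
have [w [Dw [Uw _ fw]]] := Ddense y ydom _ lt_near.
(* [g_le] at [- (w - z)] gives [g (w - z) >= 0], against pseudoconvexity. *)
have := UD w (conj Uw Dw) fw g gz; rewrite ltNge -[w - z]opprK linearN.
by rewrite oppr_ge0 g_le.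
Qed.

End Pseudoconvexity.

(** * Global pseudoconvexity from the last maximum on a segment *)

Theorem theorem4p2 (R : realType) (X : completeNormedModType R)
    (f : X -> \bar R) (D : set X)
    (f_gtNy : forall x : X, f x != -oo%E)
    (f_lip : locally_lipschitz f)
    (domf_convex : convex_set (effective_dom f : set (convex_lmodType X)))
    (D_sub : D `<=` effective_dom f)
    (D_dense : self_segment_dense D (effective_dom f))
    (f_loc : locally_pseudoconvex_on D f)
    (df_lsc :
      lower_semicontinuous_set_valued (clarke_rockafellar_subdifferential f))
    (df_neq0 : forall x y : X, effective_dom f x -> effective_dom f y ->
      x != y ->
      forall z : X, (segment x y `&` ~` D) z ->
      forall g : dual X, clarke_rockafellar_subdifferential f z g ->
      g (x - y) != 0) :
  pseudoconvex f.
Proof.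
move=> x y xdom ydom fyx g gx; rewrite ltNge; apply/negP => gyx.
pose v := y - x; pose phi (t : R) := fine (f (x + t *: v)).
have dom_seg t : t \in `[0, 1] -> effective_dom f (x + t *: v).
  exact: effective_dom_segment.
have phi_cont : {in `[0, 1], continuous phi}.
  move=> t t01.
  apply: (@continuous_comp R X R (fun t => x + t *: v) (fine \o f)).
    by apply: cvgD; [exact: cvg_cst|apply: cvgZr_tmp; exact: cvg_id].
  exact: locally_lipschitz_continuous (dom_seg t t01).
have phi10 : phi 1 < phi 0.
  rewrite /phi scale1r scale0r addr0 /v addrC subrK.
  by rewrite -lte_fin !fineK.
have [t t01 [tmax tlast]] := exists_last_argmax R phi 0 1 ler01 phi_cont.
have t1 : t < 1.
  have : phi t != phi 1.
    by rewrite gt_eqF// (lt_le_trans phi10)// tmax// in_itv/= lexx ler01.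
  move: t01; rewrite in_itv/= lt_neqAle => /andP[_ ->]; rewrite andbT.
  by apply: contraNneq => ->.
have t0 : 0 <= t by move/itvP: t01 => ->.
pose z := x + t *: v; have zdom : effective_dom f z := dom_seg t t01.
have zE s : z + s *: v = x + (t + s) *: v by rewrite -addrA -scalerDl.
have [g1 g1z g1v] :
    exists2 g1, clarke_rockafellar_subdifferential f z g1 & 0 <= g1 v.
  have [t00|tN0] := eqVneq t 0.
    have zx : z = x by rewrite /z t00 scale0r addr0.
    by exists g; [rewrite zx; exact: gx|exact: gyx].
  have {}tN0 : 0 < t by rewrite lt_neqAle eq_sym tN0.
  apply: subdifferential_ge0 => //; exists t => // s /andP[s0 st].
  rewrite -scaleNr zE; apply: tmax; rewrite in_itv/=; lra.
have [Dz|nDz] := pselect (D z).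
  have [U [oU Uz] UD] := f_loc z Dz.
  have /nbhs_ballP[e /= e0 eU] := open_nbhs_nbhs (conj oU Uz).
  have [d [d0 _ dU]] := ball_translate z e v e0.
  (* [d] keeps [z + s *: v] in [U], and [1 - t] keeps it on the segment. *)
  pose m := Num.min d (1 - t).
  have m0 : 0 < m by rewrite lt_min d0 subr_gt0.
  have [s s0] : exists2 s, 0 < s & s < m.
    by exists (m / 2); [rewrite divr_gt0|rewrite ltr_pdivrMr// ltr_pMr// ltr1n].
  rewrite /m lt_min => /andP[sd st].
  have st01 : t + s \in `[0, 1] by rewrite in_itv/=; lra.
  (* [z + s *: v] may lie outside [D], so local pseudoconvexity reaches it through density. *)
  have gs : g1 (z + s *: v - z) < 0.
    apply: (pseudoconvex_at_dense f f_lip D U z _ g1 _ _ _ g1z zdom) => //.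
    - exact: D_dense.1.
    - by move=> w UDw; apply: UD.
    - by rewrite zE; exact: dom_seg.
    - by apply/eU/dU; [exact: ballxx|rewrite s0].
    - rewrite zE -(fineK (dom_seg _ st01)) -(fineK zdom) lte_fin.
      by apply: tlast => //; rewrite ltrDl.
  move: gs; rewrite addrC addKr linearZ/= -[_ *: _]/(s * g1 v).
  by rewrite ltNge mulr_ge0// ltW.
have [g2 g2z g2v] :
    exists2 g2, clarke_rockafellar_subdifferential f z g2 & 0 <= g2 (- v).
  apply: subdifferential_ge0 => //; exists (1 - t); first by rewrite subr_gt0.
  move=> s /andP[s0 st]; rewrite scalerN opprK zE.
  by apply: tmax; rewrite in_itv/=; lra.
rewrite linearN oppr_ge0 in g2v.
have xy : x != y by apply: contraTneq fyx => ->; rewrite ltxx.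
have zseg : segment x y z by exists t.
have gN0 g' : clarke_rockafellar_subdifferential f z g' -> g' v != 0.
  by move=> /(df_neq0 x y xdom ydom xy z (conj zseg nDz));
     rewrite -opprB linearN oppr_eq0.
have g1N0 := gN0 g1 g1z.
have g1gt0 : 0 < g1 v by rewrite lt_neqAle eq_sym g1N0.
(* [a] solves [a * g1 v + (1 - a) * g2 v = 0]. *)
pose a : R := - g2 v / (g1 v - g2 v).
have den0 : 0 < g1 v - g2 v by rewrite subr_gt0 (le_lt_trans g2v).
have a01 : 0 <= a <= 1.
  rewrite divr_ge0 ?oppr_ge0 ?(ltW den0)//= ler_pdivrMr// mul1r.
  by rewrite addrC lerDl ltW.
have := gN0 _ (subdifferential_convex f z g1 g2 a a01 g1z g2z).
rewrite -[X in X != 0]/(a * g1 v + (1 - a) * g2 v) => /eqP; apply.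
by rewrite /a; field; rewrite gt_eqF.
Qed.
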